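(* Let $G$ be a connected simple graph with $n\ge 2$ vertices, and let $\Phi=\{\phi_i\}_{i\in[n]}$ be a $G(n,n-1)$-frame for $\mathbb{C}^{n-1}$. Then the canonical dual frame of $\Phi$ is the unique spectrally optimal dual frame of $\Phi$ for $1$-erasure.
   Context: Write $[n]=\{1,\dots,n\}$; inner products on $\mathbb{C}^d$ are standard and linear in the first argument. A finite sequence $\Phi=\{\phi_i\}_{i\in[n]}$ in $\mathbb{C}^d$ is a frame for $\mathbb{C}^d$ if there are constants $0<A\le B$ with $A\|f\|^2\le\sum_{i\in[n]}|\langle f,\phi_i\rangle|^2\le B\|f\|^2$ for all $f\in\mathbb{C}^d$. Its frame operator is $S_\Phi f=\sum_{i\in[n]}\langle f,\phi_i\rangle\phi_i$ (invertible). A frame $\Psi=\{\psi_i\}_{i\in[n]}$ of $\mathbb{C}^d$ is a dual frame of $\Phi$ if $f=\sum_{i\in[n]}\langle f,\phi_i\rangle\psi_i=\sum_{i\in[n]}\langle f,\psi_i\rangle\phi_i$ for all $f\in\mathbb{C}^d$; $D_\Phi$ denotes the set of dual frames of $\Phi$. The canonical dual frame of $\Phi$ is $S_\Phi^{-1}\Phi:=\{S_\Phi^{-1}\phi_i\}_{i\in[n]}\in D_\Phi$. Spectral optimality: for $\Psi\in D_\Phi$ and $\Lambda\subset[n]$, the error operator is $E_{\Phi,\Psi,\Lambda}(f)=\sum_{i\in\Lambda}\langle f,\phi_i\rangle\psi_i$ on $\mathbb{C}^d$, and for $1\le r<n$, $\rho^{(r)}_{\Phi,\Psi}:=\max\{\rho(E_{\Phi,\Psi,\Lambda}):\Lambda\subset[n],\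 |\Lambda|=r\}$, where $\rho(\cdot)$ is the spectral radius. Put $\rho^{(r)}_\Phi:=\min\{\rho^{(r)}_{\Phi,\widetilde\Psi}:\widetilde\Psi\in D_\Phi\}$. $\Psi\in D_\Phi$ is a spectrally optimal dual frame of $\Phi$ for $1$-erasure if $\rho^{(1)}_{\Phi,\Psi}=\rho^{(1)}_\Phi$. Graph frames: for a simple graph $G$ with vertices $v_1,\dots,v_n$, the Laplacian matrix is $L(G)=D(G)-A(G)$ (degree matrix minus adjacency matrix). A frame $\Phi=\{\phi_i\}_{i\in[n]}$ for $\mathbb{C}^k$ is a $G(n,k)$-frame (frame generated by $G$) if its Gramian matrix $\mathcal{G}_\Phi=[\langle\phi_j,\phi_i\rangle]_{i,j\in[n]}$ equals $L(G)$. *)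

(* Defs.v *)
(* MathComp with MathComp-Analysis; C is [R[i]] for an arbitrary [R : realType]. *)
From HB Require Import structures.
From mathcomp Require Export all_boot all_order all_algebra.
From mathcomp Require Export spectral complex.
From mathcomp Require Export boolp classical_sets reals.

Set Implicit Arguments.
Unset Strict Implicit.
Unset Printing Implicit Defensive.

Import Order.TTheory GRing.Theory Num.Theory.

Local Open Scope ring_scope.
Local Open Scope complex_scope.
Local Open Scope classical_set_scope.

Section Frames.
Variables (R : realType) (n d : nat).
Local Notation C := R[i].
Local Notation V := 'rV[C]_d.
Implicit Types (phi psi : 'I_n -> V) (f : V).

(* [dotmx u v] is linear in [u] and conjugate-linear in [v]; [dotmx f f] is
   the squared norm.  The inequalities are in the partial order of C, under
   which all the terms below are real. *)
Definition is_frame phi : Prop :=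
  exists A B : R, [/\ 0 < A, A <= B &
    forall f, A%:C * dotmx f f <= \sum_i `|dotmx f (phi i)| ^+ 2
           /\ \sum_i `|dotmx f (phi i)| ^+ 2 <= B%:C * dotmx f f].

Definition frame_operator phi f : V := \sum_i dotmx f (phi i) *: phi i.

Definition dual_frames phi : set ('I_n -> V) :=
  [set psi | is_frame psi /\
     forall f, f = \sum_i dotmx f (phi i) *: psi i
            /\ f = \sum_i dotmx f (psi i) *: phi i].

(* Linear operators on C^d act on row vectors: [f *m lin1_mx T = T f] for
   linear [T], so the inverse operator is [mulmxr (invmx (lin1_mx T))]. *)
Definition canonical_dual phi : 'I_n -> V :=
  fun i => phi i *m invmx (lin1_mx (frame_operator phi)).

Definition error_operator phi psi (L : {set 'I_n}) f : V :=
  \sum_(i in L) dotmx f (phi i) *: psi i.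

Definition spectral_radius (M : 'M[C]_d) : R :=
  sup [set ComplexField.Normc.normc a | a in [set a : C | eigenvalue M a]].

Definition erasure_radius (r : nat) phi psi : R :=
  \big[Num.max/0]_(L : {set 'I_n} | #|L| == r)
    spectral_radius (lin1_mx (error_operator phi psi L)).

(* The minimum over all duals is written as an infimum; a dual whose radius
   equals the infimum attains it, so nothing changes for optimality. *)
Definition optimal_erasure_radius (r : nat) phi : R :=
  inf [set erasure_radius r phi psi | psi in dual_frames phi].

Definition spectrally_optimal_dual (r : nat) phi psi : Prop :=
  dual_frames phi psi /\
  erasure_radius r phi psi = optimal_erasure_radius r phi.

Definition gramian phi : 'M[C]_n := \matrix_(i, j) dotmx (phi j) (phi i).

End Frames.

Section Graphs.
Variables (K : pzRingType) (n : nat) (e : rel 'I_n).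

Definition adjacency_mx : 'M[K]_n := \matrix_(i, j) (e i j)%:R.

Definition degree_mx : 'M[K]_n := diag_mx (\row_i #|[set j | e i j]%SET|%:R).

Definition laplacian_mx : 'M[K]_n := degree_mx - adjacency_mx.

End Graphs.

Definition graph_frame (R : realType) (n k : nat) (e : rel 'I_n)
    (phi : 'I_n -> 'rV[R[i]]_k) : Prop :=
  is_frame phi /\ gramian phi = laplacian_mx R[i] e.

(* Main.v *)
(* Write F for the matrix with rows phi_i and S = F^* F.  The rows of the
   Laplacian sum to zero, hence sum_i phi_i = 0, and F S^-1 F^* is the projection
   I - J/n onto the sum-zero vectors (J the all-ones matrix).  The error operator
   for the erasure {i} has rank one and spectral radius |<psi_i, phi_i>|, so all
   n radii of the canonical dual equal (n-1)/n.  For any dual psi the trace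
   sum_i <psi_i, phi_i> is n-1: the largest radius is at least (n-1)/n, with
   equality only if all <psi_i, phi_i> = (n-1)/n.  As psi_i - S^-1 phi_i = h does
   not depend on i, equality gives <h, phi_i> = 0 for all i, whence h = 0. *)
Require Import Defs.

Set Implicit Arguments.
Unset Strict Implicit.
Unset Printing Implicit Defensive.

Import Order.TTheory GRing.Theory Num.Theory.

Local Open Scope ring_scope.
Local Open Scope complex_scope.
Local Open Scope sesquilinear_scope.

(** * Adjoints and Hermitian idempotents *)

Lemma adjmxM (C : numClosedFieldType) (m n p : nat) (A : 'M[C]_(m, n))
    (B : 'M[C]_(n, p)) : (A *m B)^t* = B^t* *m A^t*.
Proof. by rewrite trmx_mul map_mxM. Qed.

(** The trace of [Q = Q Q^*] is the sum of the squared norms of the rows of [Q]. *)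
Lemma idempotent_hermitian_tr0 (C : numClosedFieldType) (n : nat)
    (Q : 'M[C]_n) : Q^t* = Q -> Q *m Q = Q -> \tr Q = 0 -> Q = 0.
Proof.
move=> Qherm Qidem trQ0.
have rowQ0 : \sum_i dotmx (row i Q) (row i Q) = 0.
  rewrite -[RHS]trQ0 -{3}Qidem -{4}Qherm; apply: eq_bigr => i _.
  by rewrite dotmxE !mxE; apply: eq_bigr => j _; rewrite !mxE.
apply/row_matrixP => i; rewrite row0; apply/eqP.
rewrite -(dnorm_eq0 (@dotmx C n)); apply/eqP.
by apply: (psumr_eq0P _ rowQ0) => // j _; exact: dnorm_ge0.
Qed.

(** * Frames as matrices acting on row vectors *)

Section FrameMatrix.
Variables (R : realType) (n d : nat).
Local Notation C := R[i].
Implicit Types (phi psi : 'I_n -> 'rV[C]_d).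

Definition frame_mx phi : 'M[C]_(n, d) := \matrix_i phi i.

Lemma frame_mx_inj : injective frame_mx.
Proof.
move=> phi psi eqF; apply: funext => i.
by have /(congr1 (row i)) := eqF; rewrite !rowK.
Qed.

Lemma dotmx_frame_mx phi f i :
  dotmx f (phi i) = (f *m (frame_mx phi)^t* ) 0 i.
Proof.
by rewrite dotmxE !mxE; apply: eq_bigr => k _; rewrite !mxE.
Qed.

Lemma dotmx_frames phi psi i j :
  dotmx (psi i) (phi j) = (frame_mx psi *m (frame_mx phi)^t* ) i j.
Proof.
by rewrite dotmx_frame_mx !mxE; apply: eq_bigr => k _; rewrite !mxE.
Qed.

Lemma sum_dotmxZ phi psi f :
  \sum_i dotmx f (phi i) *: psi i = f *m ((frame_mx phi)^t* *m frame_mx psi).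
Proof.
rewrite mulmxA mulmx_sum_row; apply: eq_bigr => i _.
by rewrite rowK dotmx_frame_mx.
Qed.

Lemma lin1_mx_mulmxr p (f : 'rV[C]_d -> 'rV[C]_p) (M : 'M[C]_(d, p)) :
  (forall v, f v = v *m M) -> lin1_mx f = M.
Proof. by move=> fE; apply/matrixP => i j; rewrite mxE fE -rowE mxE. Qed.

Lemma canonical_dual_mx phi :
  frame_mx (canonical_dual phi) =
  frame_mx phi *m invmx ((frame_mx phi)^t* *m frame_mx phi).
Proof.
apply/row_matrixP => i; rewrite rowK row_mul rowK /canonical_dual.
by rewrite (lin1_mx_mulmxr (sum_dotmxZ phi phi)).
Qed.

Lemma sum_dotmx_sqr phi f :
  \sum_i `|dotmx f (phi i)| ^+ 2 =
  dotmx (f *m (frame_mx phi)^t* ) (f *m (frame_mx phi)^t* ).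
Proof.
under eq_bigr do rewrite dotmx_frame_mx normCK.
by rewrite dotmxE mxE; apply: eq_bigr => i _; move: (f *m _) => v; rewrite !mxE.
Qed.

End FrameMatrix.

Lemma mulmx_bounded (R : realType) (m p : nat) (M : 'M[R[i]]_(m, p)) :
  exists2 B : R, 0 < B &
    forall f, dotmx (f *m M) (f *m M) <= B%:C * dotmx f f.
Proof.
pose c j := (col j M)^t*.
(* The squared Frobenius norm of [M], as Cauchy-Schwarz on each column gives; the added 1 keeps it
   positive for [M = 0]. *)
pose b : R[i] := 1 + \sum_j dotmx (c j) (c j).
have b_gt0 : 0 < b.
  by rewrite ltr_wpDr ?ltr01// sumr_ge0// => j _; exact: dnorm_ge0.
have bE : (complex.Re b)%:C = b by rewrite RRe_real ?gtr0_real.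
exists (complex.Re b) => [|f]; first by rewrite -ltcR bE.
rewrite bE.
have -> : dotmx (f *m M) (f *m M) = \sum_j `|dotmx f (c j)| ^+ 2.
  rewrite dotmxE mxE; apply: eq_bigr => j _.
  have -> : dotmx f (c j) = (f *m M) 0 j.
    by rewrite dotmxE trmxCK !mxE; apply: eq_bigr => k _; rewrite !mxE.
  by rewrite normCK; move: (f *m M) => v; rewrite !mxE.
have le_CS : \sum_j `|dotmx f (c j)| ^+ 2 <=
             (\sum_j dotmx (c j) (c j)) * dotmx f f.
  rewrite mulr_suml; apply: ler_sum => j _.
  by rewrite mulrC; apply: (CauchySchwarz (@dotmx _ m) f (c j)).
by rewrite (le_trans le_CS)// ler_wpM2r ?dnorm_ge0// /b lerDr ler01.
Qed.

(** * Dual frames as one-sided inverses *)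

Section Duals.
Variables (R : realType) (n d : nat).
Local Notation C := R[i].
Implicit Types (phi psi : 'I_n -> 'rV[C]_d).

(** Lower bound: the bounded map [frame_mx phi] recovers [f] from its coefficients against [psi].
    Upper bound: taking these coefficients is itself bounded. *)
Lemma is_frame_of_reconstruction phi psi :
  (frame_mx psi)^t* *m frame_mx phi = 1%:M -> is_frame psi.
Proof.
move=> psi_phi.
have [B B_gt0 B_bound] := mulmx_bounded ((frame_mx psi)^t* ).
have [A A_gt0 A_bound] := mulmx_bounded (frame_mx phi).
(* The maximum ensures that the lower constant does not exceed the upper one. *)
exists A^-1, (Num.max A^-1 B); split.
- by rewrite invr_gt0.
- by rewrite le_max lexx.
- move=> f; rewrite sum_dotmx_sqr; split.
    have := A_bound (f *m (frame_mx psi)^t* ).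
    rewrite -mulmxA psi_phi mulmx1 => le_f.
    have A1_ge0 : 0 <= (A^-1)%:C :> C by rewrite lecR invr_ge0 ltW.
    rewrite (le_trans (ler_wpM2l A1_ge0 le_f))// mulrA -rmorphM mulVf ?gt_eqF//.
    by rewrite mul1r.
  rewrite (le_trans (B_bound f))// ler_wpM2r ?dnorm_ge0//.
  by rewrite lecR le_max lexx orbT.
Qed.

(** The two reconstruction formulas are adjoint to each other, and the second one makes [psi] a
    frame. *)
Lemma dual_framesP phi psi :
  dual_frames phi psi <-> (frame_mx phi)^t* *m frame_mx psi = 1%:M.
Proof.
split=> [[_ dual]|phi_psi].
  apply/row_matrixP => i; rewrite !rowE mulmx1 -sum_dotmxZ.
  by have [<-] := dual (delta_mx 0 i).
have psi_phi : (frame_mx psi)^t* *m frame_mx phi = 1%:M.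
  by rewrite -[frame_mx phi]trmxCK -adjmxM phi_psi trmx1 map_mx1.
split; first exact: is_frame_of_reconstruction psi_phi.
by move=> f; rewrite !sum_dotmxZ phi_psi psi_phi mulmx1.
Qed.

Lemma analysis_inj phi (f : 'rV[C]_d) :
  is_frame phi -> f *m (frame_mx phi)^t* = 0 -> f = 0.
Proof.
move=> [A [B [A_gt0 _ bounds]]] f0; apply/eqP.
rewrite -(dnorm_eq0 (@dotmx C d)); apply/eqP/le_anti.
rewrite dnorm_ge0 andbT; have [+ _] := bounds f.
rewrite sum_dotmx_sqr f0 linear0l pmulr_rle0// ltcR.
by [].
Qed.

Lemma frame_operator_unit phi :
  is_frame phi -> ((frame_mx phi)^t* *m frame_mx phi : 'M_d) \in unitmx.
Proof.
move=> phi_frame; rewrite -row_free_unit; apply: inj_row_free => f fS0.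
apply: (analysis_inj phi_frame); set g := f *m _.
have /eqP : dotmx g g = 0.
  by rewrite dotmxE /g adjmxM trmxCK mulmxA -[f *m _ *m _]mulmxA fS0 mul0mx mxE.
by rewrite dnorm_eq0 => /eqP.
Qed.

Lemma canonical_dual_dual phi :
  is_frame phi -> dual_frames phi (canonical_dual phi).
Proof.
move=> phi_frame; apply/dual_framesP.
by rewrite canonical_dual_mx mulmxA mulmxV ?frame_operator_unit.
Qed.

Lemma dual_trace phi psi :
  dual_frames phi psi -> \sum_i dotmx (psi i) (phi i) = d%:R.
Proof.
move=> /dual_framesP phi_psi; under eq_bigr do rewrite dotmx_frames.
by rewrite -/(mxtrace _) mxtrace_mulC phi_psi mxtrace1.
Qed.

End Duals.

(** * Spectral radii for one erasure *)

Section ErasureRadius.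
Variables (R : realType) (n d : nat).
Local Notation C := R[i].
Local Notation normc := ComplexField.Normc.normc.
Implicit Types (phi psi : 'I_n -> 'rV[C]_d).

(** Pairing the eigenvector equation with [u] shows that every eigenvalue is 0 or [dotmx v u]; a
    nonzero [dotmx v u] has eigenvector [v]. *)
Lemma spectral_radius_rank1 (u v : 'rV[C]_d) :
  spectral_radius (u^t* *m v) = normc (dotmx v u).
Proof.
set N := u^t* *m v; set c := dotmx v u; rewrite /spectral_radius.
have mulN w : w *m N = dotmx w u *: v.
  by rewrite /N mulmxA [w *m _]mx11_scalar mul_scalar_mx dotmxE.
have eigN a : eigenvalue N a -> a = 0 \/ a = c.
  move=> /eigenvalueP [w]; rewrite mulN => eq_w w_neq0.
  have [t0|t_neq0] := eqVneq (dotmx w u) 0.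
    move/eqP: eq_w; rewrite t0 scale0r eq_sym scaler_eq0 (negPf w_neq0) orbF.
    by move/eqP; left.
  right; have /(congr1 (fun x => dotmx x u)) := eq_w.
  by rewrite !linearZl_LR /= mulrC => /(mulIf t_neq0) <-.
set E := (X in sup X).
have [c0|c_neq0] := eqVneq c 0.
  (* The spectrum may be empty, as when [d = 0]; [sup] then takes the value 0. *)
  have /subset_set1 [->|->] : (E `<=` [set 0])%classic.
    by move=> _ [a /eigN + <-]; rewrite c0 => -[] ->; exact: ComplexField.Normc.normc0.
  - by rewrite sup0 c0 ComplexField.Normc.normc0.
  - by rewrite sup1 c0 ComplexField.Normc.normc0.
have Ec : E (normc c).
  exists c => //; apply/eigenvalueP; exists v; first exact: mulN.
  by apply: contra_neq c_neq0 => v0; rewrite /c v0 linear0l.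
have ubE : ubound E (normc c).
  move=> _ [a /eigN + <-] => -[] ->//.
  by rewrite ComplexField.Normc.normc0 -lecR; exact: (normr_ge0 c).
apply/le_anti/andP; split; first by apply: ge_sup => //; exists (normc c).
by apply: ub_le_sup => //; exists (normc c).
Qed.

(** Erasing one index leaves a rank-one operator. The condition on [m] matches the default value 0
    of the maximum. *)
Lemma erasure_radius1_le phi psi (m : R) : 0 <= m ->
  (erasure_radius 1 phi psi <= m) <->
  (forall i, `|dotmx (psi i) (phi i)| <= m%:C).
Proof.
move=> m_ge0.
have radE i : spectral_radius (lin1_mx (error_operator phi psi [set i])) =
              normc (dotmx (psi i) (phi i)).
  rewrite -spectral_radius_rank1; congr spectral_radius.
  apply: lin1_mx_mulmxr => f; rewrite /error_operator big_set1.
  by rewrite mulmxA [f *m _]mx11_scalar mul_scalar_mx dotmxE.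
split=> [/bigmax_leP [_ le_m] i | le_m].
  by have := le_m [set i]%SET; rewrite cards1 radE -lecR; apply.
apply/bigmax_leP; split=> // L /cards1P [i ->].
by rewrite radE -lecR; exact: le_m.
Qed.

Lemma erasure_radius_ge0 r phi psi : 0 <= erasure_radius r phi psi.
Proof. exact: bigmax_ge_id. Qed.

End ErasureRadius.

(* The trace of the cross Gramian of a dual pair is [d], so the largest of its
   [n] diagonal entries has modulus at least [d / n]. *)
Lemma erasure_radius1_ge (R : realType) (n d : nat)
    (phi psi : 'I_n -> 'rV[R[i]]_d) : (0 < n)%N ->
  dual_frames phi psi -> d%:R / n%:R <= erasure_radius 1 phi psi.
Proof.
move=> n_gt0 /dual_trace tr_d.
have /(erasure_radius1_le phi psi (erasure_radius_ge0 1 phi psi)) le_r :=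
  lexx (erasure_radius 1 phi psi).
rewrite ler_pdivrMr ?ltr0n// -lecR rmorph_nat -tr_d.
rewrite (le_trans (real_ler_norm _))//; first by rewrite tr_d realn.
rewrite (le_trans (ler_norm_sum _ _ _))// (le_trans (ler_sum _ (fun i _ => le_r i)))//.
by rewrite sumr_const card_ord rmorphM rmorph_nat mulr_natr.
Qed.

(** Equality case of the triangle inequality: [n] numbers of modulus at most [d / n] with sum [d]
    all equal [d / n]. *)
Lemma dual_diagonal (R : realType) (n d : nat)
    (phi psi : 'I_n -> 'rV[R[i]]_d) : (0 < n)%N ->
  dual_frames phi psi -> erasure_radius 1 phi psi <= d%:R / n%:R ->
  forall i, dotmx (psi i) (phi i) = d%:R / n%:R.
Proof.
move=> n_gt0 /dual_trace tr_d.
have dn_ge0 : 0 <= d%:R / n%:R :> R by rewrite divr_ge0 ?ler0n.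
move=> /(erasure_radius1_le phi psi dn_ge0) le_dn i.
pose a j := dotmx (psi j) (phi j).
apply: (@normC_sum_upper _ _ xpredT a (fun=> d%:R / n%:R)) => // [j _|].
  by rewrite (le_trans (le_dn j))// fmorph_div !rmorph_nat.
rewrite tr_d sumr_const card_ord -[RHS]mulr_natr divfK//.
by rewrite pnatr_eq0 -lt0n.
Qed.

(** * Frames of [d + 1] vectors with zero sum *)

Section Corank1.
Variables (R : realType) (n d : nat) (phi : 'I_n -> 'rV[R[i]]_d).
Hypotheses (n_eq : n = d.+1) (phi_frame : is_frame phi).
Hypothesis phi_sum0 : \sum_i phi i = 0.

Let F := frame_mx phi.
Let S := F^t* *m F.
Let P := F *m invmx S *m F^t*.
Let J : 'M[R[i]]_n := const_mx 1.

Let S_unit : S \in unitmx. Proof. exact: frame_operator_unit. Qed.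

Let n_neq0 : n%:R != 0 :> R[i]. Proof. by rewrite n_eq pnatr_eq0. Qed.

Let ratioE : d%:R / n%:R = 1 - n%:R^-1 :> R[i].
Proof.
apply: (mulIf n_neq0); rewrite divfK// mulrBl mul1r mulVf//.
by rewrite n_eq -[d.+1]addn1 natrD addrK.
Qed.

Let Jherm : J^t* = J.
Proof. by apply/matrixP => i j; rewrite !mxE conjC1. Qed.

Let JF : J *m F = 0.
Proof.
apply/row_matrixP => i; rewrite row0 row_mul mulmx_sum_row -[RHS]phi_sum0.
by apply: eq_bigr => j _; rewrite !mxE scale1r rowK.
Qed.

Let FJ : F^t* *m J = 0.
Proof. by rewrite -Jherm -adjmxM JF trmx0 map_mx0. Qed.

(* Both sides are orthogonal projections onto the range of the analysis
   operator: it is contained in the sum-zero vectors and has dimension n - 1. *)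
Lemma canonical_cross_gramian : P = 1%:M - n%:R^-1 *: J.
Proof.
have PP : P *m P = P.
  by rewrite /P !mulmxA -[_ *m F^t* *m F]mulmxA -/S mulmxKV.
have PJ : P *m J = 0 by rewrite /P -mulmxA FJ mulmx0.
have JP : J *m P = 0 by rewrite /P !mulmxA JF !mul0mx.
have JJ : J *m J = n%:R *: J.
  apply/matrixP => i j; rewrite !mxE; under eq_bigr do rewrite !mxE mulr1.
  by rewrite sumr_const card_ord mulr1.
have Sherm : S^t* = S by rewrite /S adjmxM trmxCK.
have Pherm : P^t* = P.
  by rewrite /P !adjmxM trmxCK trmx_inv map_invmx Sherm mulmxA.
(* The projection onto the complement of both the range of [P] and the constants. *)
pose Q := 1%:M - P - n%:R^-1 *: J.
have QP : Q *m P = 0.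
  by rewrite /Q 2!mulmxBl mul1mx PP subrr -scalemxAl JP scaler0 subr0.
have QJ : Q *m J = 0.
  rewrite /Q 2!mulmxBl mul1mx PJ subr0 -scalemxAl JJ scalerA mulVf; last exact: n_neq0.
  by rewrite scale1r subrr.
suff: Q = 0 by move=> /eqP; rewrite /Q addrAC subr_eq0 => /eqP <-.
apply: idempotent_hermitian_tr0.
- rewrite /Q !linearB /= linearZ /= !map_mxB map_mxZ Pherm Jherm.
  by rewrite trmx1 map_mx1 fmorphV rmorph_nat.
- by rewrite {2}/Q 2!mulmxBr mulmx1 QP -scalemxAr QJ scaler0 !subr0.
(* By cyclicity [P] has trace [d], so [Q] has trace [n - d - 1 = 0]. *)
- rewrite /Q !linearB /= linearZ /= mxtrace1 /P -mulmxA mxtrace_mulC -mulmxA.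
  rewrite -/S mulVmx// mxtrace1 /mxtrace; under eq_bigr do rewrite mxE.
  by rewrite sumr_const card_ord mulVf// n_eq -natrB// subSnn subrr.
Qed.

(* The deviation [X] of the cross Gramian of [psi] from [P] satisfies
   [P *m X = 0], so its rows are all equal; a zero diagonal forces [X = 0]. *)
Lemma dual_eq_canonical psi : dual_frames phi psi ->
  (forall i, dotmx (psi i) (phi i) = d%:R / n%:R) -> psi = canonical_dual phi.
Proof.
move=> /dual_framesP phi_psi diag; apply: frame_mx_inj.
rewrite canonical_dual_mx -/F -/S.
pose X := frame_mx psi *m F^t* - P.
have PX : P *m X = 0.
  rewrite /X mulmxBr /P !mulmxA -[_ *m F^t* *m frame_mx psi]mulmxA phi_psi.
  by rewrite mulmx1 -[_ *m F^t* *m F]mulmxA -/S mulmxKV// subrr.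
have XE : X = n%:R^-1 *: (J *m X).
  move/eqP: PX; rewrite canonical_cross_gramian mulmxBl mul1mx subr_eq0.
  by rewrite -scalemxAl => /eqP.
have X_rows i j k : X i k = X j k.
  rewrite XE !mxE; congr (_ * _).
  by apply: eq_bigr => l _; rewrite !mxE.
have X_diag i : X i i = 0.
  rewrite /X mxE -dotmx_frames diag mxE canonical_cross_gramian !mxE eqxx.
  by rewrite mulr1 ratioE subrr.
have X0 : X = 0 by apply/matrixP => i j; rewrite (X_rows i j) X_diag mxE.
(* Since [P F = F], multiplying by [F] yields [frame_mx psi *m S = F], and [S] is invertible. *)
have /(congr1 (mulmx^~ F)) : frame_mx psi *m F^t* = P.
  by apply/eqP; rewrite -subr_eq0 -/X X0.
by rewrite /P -!mulmxA -/S mulVmx// mulmx1 => <-; rewrite mulmxK.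
Qed.

Lemma canonical_dual_radius :
  erasure_radius 1 phi (canonical_dual phi) = d%:R / n%:R.
Proof.
apply/le_anti/andP; split; last first.
  apply: erasure_radius1_ge; first by rewrite n_eq.
  exact: canonical_dual_dual.
apply/erasure_radius1_le => [|i]; first by rewrite divr_ge0 ?ler0n.
rewrite dotmx_frames canonical_dual_mx -/F -/S -/P canonical_cross_gramian.
rewrite !mxE eqxx mulr1 -ratioE fmorph_div !rmorph_nat ger0_norm//.
by rewrite divr_ge0 ?ler0n.
Qed.

Lemma canonical_dual_unique_optimal :
  spectrally_optimal_dual 1 phi (canonical_dual phi) /\
  (forall psi, spectrally_optimal_dual 1 phi psi -> psi = canonical_dual phi).
Proof.
have n_gt0 : (0 < n)%N by rewrite n_eq.
have can_dual := canonical_dual_dual phi_frame.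
have opt : optimal_erasure_radius 1 phi = d%:R / n%:R.
  (* Used twice: it bounds the infimum from below, and it supplies the boundedness that [ge_inf]
     requires. *)
  have lb : lbound [set erasure_radius 1 phi psi | psi in dual_frames phi]%classic
                   (d%:R / n%:R).
    by move=> _ [psi psi_dual <-]; exact: erasure_radius1_ge.
  apply/le_anti/andP; split.
    rewrite -canonical_dual_radius; apply: ge_inf; first by exists (d%:R / n%:R).
    by exists (canonical_dual phi).
  apply: lb_le_inf => //.
  by exists (erasure_radius 1 phi (canonical_dual phi)), (canonical_dual phi).
split=> [|psi [psi_dual psi_opt]].
  by split; rewrite ?opt ?canonical_dual_radius.
apply: dual_eq_canonical => //.
by apply: dual_diagonal => //; rewrite psi_opt opt.
Qed.

End Corank1.

(** * From the Laplacian to zero-sum frames *)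

Lemma laplacian_mx_row_sum (K : pzRingType) (n : nat) (e : rel 'I_n) i :
  irreflexive e -> \sum_j laplacian_mx K e i j = 0.
Proof.
move=> e_irr; under eq_bigr do rewrite !mxE.
rewrite sumrB (bigD1 i)//= eqxx big1 ?addr0; last first.
  by move=> j /negPf; rewrite eq_sym => ->.
by rewrite -natr_sum -big_mkcond /= sum1dep_card subrr.
Qed.

(** The inner product of the sum with [phi i] is the [i]-th row sum of the Gramian, hence 0; the
    lower frame bound then kills the sum. *)
Lemma graph_frame_sum0 (R : realType) (n k : nat) (e : rel 'I_n)
    (phi : 'I_n -> 'rV[R[i]]_k) : irreflexive e ->
  graph_frame e phi -> \sum_i phi i = 0.
Proof.
move=> e_irr [phi_frame gramE]; apply: (analysis_inj phi_frame).
apply/rowP => i; rewrite mulmx_suml summxE [RHS]mxE.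
rewrite -[RHS](laplacian_mx_row_sum R[i] i e_irr) -gramE.
by apply: eq_bigr => j _; rewrite -dotmx_frame_mx mxE.
Qed.

Theorem corollary3p1 (R : realType) (n : nat) (hn : (2 <= n)%N)
    (e : rel 'I_n) (e_sym : symmetric e) (e_irr : irreflexive e)
    (e_conn : forall i j : 'I_n, connect e i j)
    (phi : 'I_n -> 'rV[complex R]_(n - 1)) (hphi : graph_frame e phi) :
  spectrally_optimal_dual 1 phi (canonical_dual phi) /\
  (forall psi : 'I_n -> 'rV[complex R]_(n - 1),
     spectrally_optimal_dual 1 phi psi -> psi = canonical_dual phi).
Proof.
apply: canonical_dual_unique_optimal.
- by rewrite subn1 prednK// ltnW.
- by case: hphi.
- exact: graph_frame_sum0 hphi.
Qed.
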